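(* Let $\mathcal G$ be a fixed, connected, undirected graph on $N\ge 2$ nodes with Laplacian $L$ (largest eigenvalue $\lambda_N(L)$), let $0<\alpha<1/\lambda_N(L)$, $W=I_N-\alpha L$, $\mathbf A_{\mathrm{sys}}=W\otimes I_d-\mathbf P$ and $\sigma:=\|\mathbf A_{\mathrm{sys}}\|_2\in[0,1)$, where $\mathbf P$ is the selector projector defined in the context. Fix an integer $T\ge1$. Let $(u^k)_{k\ge0}$ be a sequence in $\mathbb R^d$ such that $\Delta u^k:=u^{k+1}-u^k$ satisfies $\|\Delta u^k\|_2\le\bar\Delta$ for all $k$, and let $\mathbf s^{k,t}$ be generated by the warm-started selector-anchored diffusion recursion of the context with $T$ inner rounds per outer iteration, with errors $\mathbf e^{k,t}=\mathbf s^{k,t}-\mathbf 1_N\otimes u^k$. Then $$\limsup_{k\to\infty}\|\mathbf e^{k,0}\|_2\le\frac{\sqrt N}{1-\sigma^T}\,\bar\Delta,\qquad \limsup_{k\to\infty}\|\mathbf e^{k,T}\|_2\le\frac{\sqrt N\,\sigma^T}{1-\sigma^T}\,\bar\Delta .$$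
   Context: Graphs are simple and unweighted; $L$ is the combinatorial graph Laplacian. $\|\cdot\|_2$ is the Euclidean/spectral norm, $\otimes$ the Kronecker product, $\mathbf 1_N$ the all-ones vector. Selector matrices: $d=\sum_{i=1}^N d_i$, vectors $u\in\mathbb R^d$ are partitioned into blocks $u_i\in\mathbb R^{d_i}$, and $\mathbf E_i\in\{0,1\}^{d\times d_i}$ is the block-column of $I_d$ corresponding to block $i$; $\mathbf P_i=\mathbf E_i\mathbf E_i^\top$, $\mathbf P=\mathrm{blkdiag}(\mathbf P_1,\dots,\mathbf P_N)$, so $\sum_i\mathbf P_i=I_d$. Recursion (D+LI): given $\mathbf s^{0,0}\in\mathbb R^{Nd}$, for each outer index $k\ge 0$ and inner index $t=0,\dots,T-1$, $$\mathbf s^{k,t+1}=(W\otimes I_d)\mathbf s^{k,t}+\mathbf P\big((\mathbf 1_N\otimes u^k)-\mathbf s^{k,t}\big),$$ with warm start $\mathbf s^{k+1,0}:=\mathbf s^{k,T}$. *)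

(* Defs.v *)
From HB Require Import structures.
From mathcomp Require Import all_boot all_order all_algebra.
From mathcomp Require Import all_classical all_reals all_analysis.
From mathcomp Require Import mxtens.

Set Implicit Arguments.
Unset Strict Implicit.
Unset Printing Implicit Defensive.

Import Order.TTheory GRing.Theory Num.Theory.

Local Open Scope classical_set_scope.
Local Open Scope ring_scope.

(** A simple graph on the nodes ['I_N] is a symmetric, irreflexive relation
    [e : rel 'I_N]; it is connected when [connect e i j] holds for all i, j. *)
Section Graph.
Variables (R : realType) (N : nat) (e : rel 'I_N).

Definition adjacency : 'M[R]_N := \matrix_(i, j) (e i j)%:R.

Definition degree_mx : 'M[R]_N := diag_mx (\row_i (#|[set j | e i j]%SET|)%:R).

Definition laplacian : 'M[R]_N := degree_mx - adjacency.

Definition mixing_mx (alpha : R) : 'M[R]_N := 1%:M - alpha *: laplacian.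

End Graph.

Definition largest_eigenvalue (R : realType) (n : nat) (A : 'M[R]_n) (l : R) :=
  eigenvalue A l /\ (forall mu : R, eigenvalue A mu -> mu <= l).

Section Norms.
Variable R : realType.

(** The library norm [`|x|] on matrices is the sup norm. *)
Definition norm2 (n : nat) (x : 'cV[R]_n) : R :=
  Num.sqrt (\sum_(i < n) x i 0 ^+ 2).

Definition spectral_norm (m n : nat) (A : 'M[R]_(m, n)) : R :=
  sup [set norm2 (A *m x) | x in [set x : 'cV[R]_n | norm2 x <= 1]].

End Norms.

(** [d i] is the size of the i-th block, so vectors in R^d with
    d = d_1 + ... + d_N are column vectors of height [\sum_i d i].  Vectors in
    R^(N d) have height [N * \sum_i d i], as produced by the Kronecker product
    [*t]: entry j of the i-th copy of R^d sits at [i * \sum_i d i + j]. *)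
Section Selector.
Variables (R : realType) (N : nat) (d : 'I_N -> nat).

Definition total_dim := (\sum_(i < N) d i)%N.

Definition block_col (i : 'I_N) : 'M[R]_(total_dim, d i) :=
  submxrow (1%:M : 'M[R]_total_dim) i.

Definition block_proj (i : 'I_N) : 'M[R]_total_dim :=
  block_col i *m (block_col i)^T.

Lemma sum_total_dim : (\sum_(i < N) total_dim = N * total_dim)%N.
Proof. by rewrite sum_nat_const card_ord. Qed.

Definition selector_mx : 'M[R]_(N * total_dim) :=
  castmx (sum_total_dim, sum_total_dim) (\mxdiag_(i < N) block_proj i).

Definition system_mx (W : 'M[R]_N) : 'M[R]_(N * total_dim) :=
  W *t (1%:M : 'M[R]_total_dim) - selector_mx.

(** The product has width [1 * 1], which is convertible to [1]. *)
Definition ones_tens (u : 'cV[R]_total_dim) : 'cV[R]_(N * total_dim) :=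
  (const_mx 1 : 'cV[R]_N) *t u.

End Selector.

(* Main.v *)
(** The error obeys e^{k,t+1} = A e^{k,t} with A = W (x) I - P symmetric,
    because W (x) I fixes 1 (x) u.  It satisfies -I < A < I: the form of
    I + A = W (x) I + (I - P) is positive definite since alpha L < I, and that
    of I - A = alpha L (x) I + P vanishes only on vectors 1 (x) v
    (connectedness) with P_i v = 0 for all i, hence v = sum_i P_i v = 0.  Thus
    |Ax| < |x| for x <> 0, and compactness of the sphere gives sigma < 1.
    Finally a_k = |e^{k,0}| satisfies
    a_{k+1} <= sigma^T a_k + sqrt N Delta. *)

Require Import Defs.
From mathcomp Require Import all_boot all_order all_algebra.
From mathcomp Require Import all_classical all_reals all_analysis.
From mathcomp Require Import mxtens.
From mathcomp Require Import ring lra.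

Import Order.TTheory GRing.Theory Num.Theory.
Import numFieldNormedType.Exports.

Local Open Scope classical_set_scope.
Local Open Scope ring_scope.

(** * Euclidean inner product and norm on column vectors *)

Section InnerProduct.
Context {R : realType}.

Definition dot {n} (x y : 'cV[R]_n) : R := (x^T *m y) 0 0.

Lemma dotE n (x y : 'cV[R]_n) : dot x y = \sum_i x i 0 * y i 0.
Proof. by rewrite /dot mxE; apply: eq_bigr => i _; rewrite mxE. Qed.

Lemma dotC n (x y : 'cV[R]_n) : dot x y = dot y x.
Proof. by rewrite !dotE; apply: eq_bigr => i _; rewrite mulrC. Qed.

Lemma dotDl n (x y z : 'cV[R]_n) : dot (x + y) z = dot x z + dot y z.
Proof. by rewrite /dot linearD mulmxDl mxE. Qed.

Lemma dotDr n (x y z : 'cV[R]_n) : dot z (x + y) = dot z x + dot z y.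
Proof. by rewrite /dot mulmxDr mxE. Qed.

Lemma dot0r n (x : 'cV[R]_n) : dot x 0 = 0.
Proof. by rewrite /dot mulmx0 mxE. Qed.

Lemma dotNl n (x z : 'cV[R]_n) : dot (- x) z = - dot x z.
Proof. by rewrite /dot linearN mulNmx mxE. Qed.

Lemma dotNr n (x z : 'cV[R]_n) : dot z (- x) = - dot z x.
Proof. by rewrite /dot mulmxN mxE. Qed.

Lemma dotZl n a (x z : 'cV[R]_n) : dot (a *: x) z = a * dot x z.
Proof. by rewrite /dot linearZ -scalemxAl mxE. Qed.

Lemma dotZr n a (x z : 'cV[R]_n) : dot z (a *: x) = a * dot z x.
Proof. by rewrite /dot -scalemxAr mxE. Qed.

Lemma dot_mulmxr m n (A : 'M[R]_(m, n)) x y :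
  dot x (A *m y) = dot (A^T *m x) y.
Proof. by rewrite /dot trmx_mul trmxK mulmxA. Qed.

Lemma dot_ge0 n (x : 'cV[R]_n) : 0 <= dot x x.
Proof. by rewrite dotE sumr_ge0 // => i _; rewrite -expr2 sqr_ge0. Qed.

Lemma dot_eq0 n (x : 'cV[R]_n) : (dot x x == 0) = (x == 0).
Proof.
apply/eqP/eqP => [|->]; last by rewrite dot0r.
rewrite dotE => /psumr_eq0P h; apply/matrixP => i j; rewrite (ord1 j) mxE.
by apply/eqP; rewrite -sqrf_eq0 expr2 h // => k _; rewrite -expr2 sqr_ge0.
Qed.

Lemma dot_gt0 n (x : 'cV[R]_n) : (0 < dot x x) = (x != 0).
Proof. by rewrite lt_def dot_eq0 dot_ge0 andbT. Qed.

Lemma norm2E n (x : 'cV[R]_n) : norm2 x = Num.sqrt (dot x x).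
Proof. by rewrite /norm2 dotE; under eq_bigr do rewrite expr2. Qed.

Lemma norm2_ge0 n (x : 'cV[R]_n) : 0 <= norm2 x.
Proof. exact: sqrtr_ge0. Qed.

Lemma norm2_sqr n (x : 'cV[R]_n) : norm2 x ^+ 2 = dot x x.
Proof. by rewrite norm2E sqr_sqrtr // dot_ge0. Qed.

Lemma norm2_gt0 n (x : 'cV[R]_n) : (0 < norm2 x) = (x != 0).
Proof. by rewrite norm2E sqrtr_gt0 dot_gt0. Qed.

Lemma norm20 n : norm2 (0 : 'cV[R]_n) = 0.
Proof. by apply/eqP; rewrite eq_le norm2_ge0 andbT leNgt norm2_gt0 eqxx. Qed.

Lemma norm2Z n a (x : 'cV[R]_n) : norm2 (a *: x) = `|a| * norm2 x.
Proof.
by rewrite !norm2E dotZl dotZr mulrA -expr2 sqrtrM ?sqr_ge0 // sqrtr_sqr.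
Qed.

Lemma norm2N n (x : 'cV[R]_n) : norm2 (- x) = norm2 x.
Proof. by rewrite !norm2E dotNl dotNr opprK. Qed.

(** Cauchy-Schwarz: with a = |x| and b = |y|, expanding 0 <= |b x - a y|^2 gives 2 a b (a b - <x,
    y>), and a b > 0 once the zero vectors are set aside. *)
Lemma dot_le_norm2 n (x y : 'cV[R]_n) : dot x y <= norm2 x * norm2 y.
Proof.
have [->|x0] := eqVneq x 0.
  by rewrite norm20 mul0r dotC dot0r.
have [->|y0] := eqVneq y 0.
  by rewrite norm20 mulr0 dot0r.
have := dot_ge0 _ (norm2 y *: x - norm2 x *: y).
rewrite !(dotDl, dotDr, dotNl, dotNr, dotZl, dotZr) -!norm2_sqr (dotC _ y x).
rewrite -norm2_gt0 in x0; rewrite -norm2_gt0 in y0.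
set a := norm2 x in x0 *; set b := norm2 y in y0 *; set c := dot x y.
rewrite (_ : _ + _ = 2 * ((a * b) * (a * b - c))); last by ring.
by rewrite pmulr_rge0 // pmulr_rge0 ?mulr_gt0 // subr_ge0.
Qed.

Lemma ler_norm2D n (x y : 'cV[R]_n) : norm2 (x + y) <= norm2 x + norm2 y.
Proof.
rewrite -(@ler_pXn2r _ 2) ?nnegrE ?addr_ge0 ?norm2_ge0 // sqrrD !norm2_sqr.
rewrite !(dotDl, dotDr) (dotC _ y x).
have := dot_le_norm2 _ x y; lra.
Qed.

(** Moving x by a small negative multiple of y = M x changes the form to first order by a negative
    multiple of |y|^2, which would make it negative unless y = 0. *)
Lemma psd_kernel n (M : 'M[R]_n) x : M^T = M ->
  (forall y, 0 <= dot y (M *m y)) -> dot x (M *m x) = 0 -> M *m x = 0.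
Proof.
move=> Msym Mpsd Mx0; apply/eqP; rewrite -dot_eq0; apply/eqP.
set y := M *m x; set a := dot y y; set c := dot y (M *m y).
have c1 : 0 < c + 1 by have := Mpsd y; rewrite -/c; lra.
(* At step t the form equals - 2 t a + t^2 c. The choice t = a / (c + 1) makes it nonpositive, and
   the + 1 covers c = 0. *)
have := Mpsd (x - (a / (c + 1)) *: y).
rewrite mulmxBr -scalemxAr -/y !(dotDl, dotDr, dotNl, dotNr, dotZl, dotZr).
rewrite Mx0 (dot_mulmxr _ _ M) Msym -/y -/a -/c.
rewrite (_ : _ + _ = - (a ^+ 2 * ((c + 2) / (c + 1) ^+ 2))); last first.
  by field; rewrite gt_eqF.
rewrite oppr_ge0 pmulr_lle0.
  by rewrite le_eqVlt ltNge sqr_ge0 orbF sqrf_eq0 => /eqP.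
by rewrite divr_gt0 ?exprn_gt0 //; lra.
Qed.

End InnerProduct.

(** * Maximum of a quadratic form on the unit sphere *)

Section Rayleigh.
Context {R : realType}.

Lemma continuous_sum (T : topologicalType) (I : Type) (r : seq I)
    (f : I -> T -> R) :
  (forall i, continuous (f i)) -> continuous (fun x => \sum_(i <- r) f i x).
Proof.
move=> fc; elim: r => [|i r IH] x.
  under eq_fun do rewrite big_nil; exact: cvg_cst.
under eq_fun do rewrite big_cons; apply: cvgD; [exact: fc|exact: IH].
Qed.

(** Row vectors are used to match the extreme value theorem [EVT_max_rV]; the form is a polynomial
    in the coordinates. *)
Lemma quad_continuous n (M : 'M[R]_n) :
  continuous (fun v : 'rV[R]_n => dot v^T (M *m v^T)).
Proof.
rewrite (_ : (fun v => _) =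
    fun v : 'rV[R]_n => \sum_i v 0 i * \sum_j M i j * v 0 j).
  have coordc i : continuous (fun v : 'rV[R]_n => v 0 i).
    exact: coord_continuous.
  have mulc (f g : 'rV[R]_n -> R) : continuous f -> continuous g ->
      continuous (fun v => f v * g v).
    by move=> fc gc v; exact: (@continuousM R _ f g v (fc v) (gc v)).
  apply: (@continuous_sum _ _ _ (fun i (v : 'rV[R]_n) =>
    v 0 i * \sum_j M i j * v 0 j)) => i; apply: (mulc) => //.
  apply: (@continuous_sum _ _ _ (fun j (v : 'rV[R]_n) =>
    M i j * v 0 j)) => j.
  by apply: mulc => // v; exact: cst_continuous.
apply/funext => v; rewrite dotE; apply: eq_bigr => i _; rewrite !mxE.
by congr (_ * _); apply: eq_bigr => j _; rewrite mxE.
Qed.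

(** Every coordinate of a unit vector has absolute value at most 1, so the sphere is bounded in the
    sup norm; it is closed as the preimage of 1 under the form of the identity. *)
Lemma sphere_compact n : compact [set v : 'rV[R]_n | dot v^T v^T = 1].
Proof.
apply: bounded_closed_compact.
  exists 1; split=> // b b1 v /= v1; apply: le_trans (ltW b1).
  rewrite /Num.norm /= mx_normrE; apply: bigmax_le => // -[i j] _ /=.
  rewrite (ord1 i) -(@ler_pXn2r _ 2) ?nnegrE // expr1n real_normK ?num_real //.
  rewrite -v1 dotE (bigD1 j) //= !mxE -expr2 lerDl sumr_ge0 // => k _.
  by rewrite -expr2 sqr_ge0.
rewrite (_ : mkset _ =
    (fun v : 'rV[R]_n => dot v^T (1%:M *m v^T)) @^-1` [set 1]).
  apply: preimage_closed; last exact: closed_eq.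
  by move=> x _; exact: quad_continuous.
by apply/seteqP; split=> v /=; rewrite mul1mx.
Qed.

(** The form attains its maximum on the sphere, and homogeneity of degree 2 extends the bound to all
    y. The vector [x0] shows that the sphere is nonempty. *)
Lemma quad_max n (M : 'M[R]_n) (x0 : 'cV[R]_n) : x0 != 0 ->
  exists x : 'cV[R]_n, dot x x = 1 /\
    forall y, dot y (M *m y) <= dot x (M *m x) * dot y y.
Proof.
move=> x00.
have unit_scale (y : 'cV[R]_n) : y != 0 ->
    dot ((norm2 y)^-1 *: y) ((norm2 y)^-1 *: y) = 1.
  move=> y0; rewrite dotZl dotZr -norm2_sqr.
  by rewrite -norm2_gt0 in y0; field; rewrite gt_eqF.
have := @EVT_max_rV R n (fun v => dot v^T (M *m v^T)) _ _ (sphere_compact n).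
case.
- by exists ((norm2 x0)^-1 *: x0)^T; rewrite /= trmxK unit_scale.
- exact/continuous_subspaceT/quad_continuous.
move=> c; rewrite inE /= => c1 cmax; exists c^T; split=> // y.
have [->|y0] := eqVneq y 0.
  by rewrite mulmx0 !dot0r mulr0.
have := cmax ((norm2 y)^-1 *: y)^T.
rewrite trmxK inE /= trmxK unit_scale // => /(_ erefl).
rewrite -scalemxAr dotZl dotZr -norm2_sqr mulrA -expr2 exprVn mulrC.
by rewrite ler_pdivrMr // exprn_gt0 // norm2_gt0.
Qed.

(* A maximiser x of the Rayleigh quotient lies in the kernel of the positive
   semidefinite matrix mu - M, so the maximum mu is an eigenvalue. *)
Lemma rayleigh_le n (M : 'M[R]_n) l : M^T = M ->
  (forall mu, eigenvalue M mu -> mu <= l) ->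
  forall y, dot y (M *m y) <= l * dot y y.
Proof.
move=> Msym Ml y; have [->|y0] := eqVneq y 0.
  by rewrite mulmx0 !dot0r mulr0.
have [x [x1 xmax]] := quad_max n M y y0.
set mu := dot x (M *m x) in xmax.
apply: le_trans (xmax y) _; apply: ler_wpM2r; first exact: dot_ge0.
apply: Ml; apply/eigenvalueP; exists x^T; last first.
  by rewrite -(inj_eq trmx_inj) trmxK trmx0 -dot_eq0 x1 oner_eq0.
apply: trmx_inj; rewrite trmx_mul Msym linearZ /= trmxK; apply/esym/eqP.
rewrite -subr_eq0 -mul_scalar_mx -mulmxBl; apply/eqP.
apply: psd_kernel => [|z|].
- by rewrite linearB /= tr_scalar_mx Msym.
- by rewrite mulmxBl mul_scalar_mx dotDr dotNr dotZr subr_ge0.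
- by rewrite mulmxBl mul_scalar_mx dotDr dotNr dotZr x1 mulr1 subrr.
Qed.

End Rayleigh.

(** * Spectral norm and strict contractions *)

Section SpectralNorm.
Context {R : realType}.

Lemma contraction_pd n (A : 'M[R]_n) x : A^T = A ->
  (forall y, y != 0 -> 0 < dot y (y + A *m y)) ->
  (forall y, y != 0 -> 0 < dot y (y - A *m y)) ->
  x != 0 -> dot (A *m x) (A *m x) < dot x x.
Proof.
(* With M = 1 - A and B = 1 + A, which commute and sum to 2,
   2 (|x|^2 - |Ax|^2) = <Mx, B M x> + <Bx, M B x>. *)
move=> Asym Np Mp x0.
have pd (B : 'M[R]_n) : (forall y, y != 0 -> 0 < dot y (y + B *m y)) ->
    x + B *m x != 0.
  by move=> Bp; apply: contraTneq (Bp x x0) => ->; rewrite dot0r ltxx.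
have N0 := pd A Np.
have M0 : x - A *m x != 0.
  by rewrite -mulNmx; apply: pd => y y0; rewrite mulNmx Mp.
have := Mp _ N0; have := Np _ M0.
rewrite !(mulmxDr, mulmxN, dotDl, dotDr, dotNl, dotNr).
rewrite !(dot_mulmxr _ _ A x) Asym !(dot_mulmxr _ _ A (A *m x)) Asym.
rewrite (dotC _ (A *m (A *m x)) x) (dot_mulmxr _ _ A x) Asym.
rewrite (dotC _ (A *m (A *m x)) (A *m x)) .
lra.
Qed.

Lemma spectral_norm_bound m n (A : 'M[R]_(m, n)) c : 0 <= c ->
  (forall x, norm2 (A *m x) <= c * norm2 x) ->
  0 <= spectral_norm A <= c.
Proof.
move=> c0 Ac.
have c_ub : ubound
    [set norm2 (A *m x) | x in [set x : 'cV[R]_n | norm2 x <= 1]] c.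
  by move=> _ [x /= x1 <-]; apply: le_trans (Ac x) _; rewrite ler_piMr.
have in0 : [set norm2 (A *m x) | x in [set x : 'cV[R]_n | norm2 x <= 1]] 0.
  by exists 0; rewrite /= ?norm20 // mulmx0 norm20.
apply/andP; split; last by apply: ge_sup => //; exists 0.
by apply: ub_le_sup => //; exists c.
Qed.

(** The constant c bounds the set of values, which makes its [sup] a genuine upper bound; the value
    at x / |x| then gives the estimate by homogeneity. *)
Lemma spectral_normP m n (A : 'M[R]_(m, n)) c : 0 <= c ->
  (forall x, norm2 (A *m x) <= c * norm2 x) ->
  forall x, norm2 (A *m x) <= spectral_norm A * norm2 x.
Proof.
move=> c0 Ac x; have [->|x0] := eqVneq x 0.
  by rewrite mulmx0 !norm20 mulr0.
rewrite -norm2_gt0 in x0; rewrite -ler_pdivrMr // mulrC.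
apply: ub_le_sup.
  exists c => _ [y /= y1 <-]; apply: le_trans (Ac y) _; by rewrite ler_piMr.
exists ((norm2 x)^-1 *: x) => /=.
  by rewrite norm2Z ger0_norm ?invr_ge0 ?norm2_ge0 // mulVf // gt_eqF.
by rewrite -scalemxAr norm2Z ger0_norm ?invr_ge0 ?norm2_ge0.
Qed.

(** Compactness turns the pointwise strict inequality into a uniform one: the maximum mu of |A x|^2
    on the sphere is attained, so mu < 1, and the square root of mu bounds A. *)
Lemma spectral_norm_lt1 n (A : 'M[R]_n) :
  (forall x, x != 0 -> dot (A *m x) (A *m x) < dot x x) ->
  0 <= spectral_norm A < 1 /\
  forall x, norm2 (A *m x) <= spectral_norm A * norm2 x.
Proof.
move=> Alt; suff [c /andP[c0 c1] Ac] :
    exists2 c : R, 0 <= c < 1 & forall x, norm2 (A *m x) <= c * norm2 x.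
  split; last exact: spectral_normP c0 Ac.
  have /andP[-> /= sc] := spectral_norm_bound _ _ _ _ c0 Ac.
  exact: le_lt_trans c1.
(* In dimension 0 the sphere is empty, and c = 0 works. *)
have [[x0 x00]|triv] := pselect (exists x : 'cV[R]_n, x != 0); last first.
  exists 0; rewrite ?lexx ?ltr01 // => x.
  have -> : x = 0 by apply/eqP/negP => /negP x0; apply: triv; exists x.
  by rewrite mulmx0 norm20 mulr0.
have [x [x1 xmax]] := quad_max n (A^T *m A) x0 x00.
rewrite -mulmxA dot_mulmxr trmxK in xmax.
set mu := dot _ _ in xmax.
exists (Num.sqrt mu).
  rewrite sqrtr_ge0 -sqrtr1 ltr_sqrt // -x1 Alt // -dot_eq0 x1 oner_eq0 //.
move=> y; rewrite !norm2E -sqrtrM ?dot_ge0 // ler_wsqrtr //.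
by have := xmax y; rewrite -mulmxA dot_mulmxr trmxK.
Qed.

End SpectralNorm.

(** * The graph Laplacian and the mixing matrix *)

Section Laplacian.
Context {R : realType} {N : nat} (e : rel 'I_N) (e_sym : symmetric e).

Let L : 'M[R]_N := laplacian R e.

Lemma laplacian_mulE (x : 'cV[R]_N) i :
  (L *m x) i 0 = \sum_j (e i j)%:R * (x i 0 - x j 0).
Proof.
rewrite /L /laplacian mulmxBl mul_diag_mx !mxE.
rewrite (_ : #|_|%:R = \sum_j (e i j)%:R :> R); last first.
  rewrite -sum1_card natr_sum big_mkcond.
  by apply: eq_bigr => j _; rewrite inE; case: (e i j).
rewrite mulr_suml -sumrB; apply: eq_bigr => j _.
by rewrite mxE mulrBr.
Qed.

(** Exchanging i and j leaves the form unchanged because [e] is symmetric; adding the two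
    expressions completes the squares. The factor 1/2 reflects that each edge occurs as two ordered
    pairs. *)
Lemma laplacian_quad (x : 'cV[R]_N) :
  dot x (L *m x) = 2^-1 * \sum_i \sum_j (e i j)%:R * (x i 0 - x j 0) ^+ 2.
Proof.
have E : dot x (L *m x) = \sum_i \sum_j x i 0 * ((e i j)%:R * (x i 0 - x j 0)).
  by rewrite dotE; apply: eq_bigr => i _; rewrite laplacian_mulE mulr_sumr.
have E' : dot x (L *m x) = \sum_i \sum_j x j 0 * ((e i j)%:R * (x j 0 - x i 0)).
  rewrite E exchange_big /=; apply: eq_bigr => i _; apply: eq_bigr => j _.
  by rewrite e_sym.
apply: (mulfI (_ : 2 != 0 :> R)); first by rewrite pnatr_eq0.
rewrite mulVKf ?pnatr_eq0 // mulr_natl mulr2n {1}E E' -big_split.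
apply: eq_bigr => i _; rewrite -big_split; apply: eq_bigr => j _ /=; ring.
Qed.

Lemma laplacian_term_ge0 (x : 'cV[R]_N) i j :
  0 <= (e i j)%:R * (x i 0 - x j 0) ^+ 2.
Proof. by rewrite mulr_ge0 ?sqr_ge0. Qed.

Lemma laplacian_psd (x : 'cV[R]_N) : 0 <= dot x (L *m x).
Proof.
rewrite laplacian_quad mulr_ge0 ?invr_ge0 // sumr_ge0 // => i _.
by rewrite sumr_ge0 // => j _; exact: laplacian_term_ge0.
Qed.

(** A vanishing sum of nonnegative terms forces x to agree across each edge, hence along any
    path. *)
Lemma laplacian_ker (e_conn : forall i j, connect e i j) (x : 'cV[R]_N) :
  dot x (L *m x) = 0 -> forall i j, x i 0 = x j 0.
Proof.
rewrite laplacian_quad => /eqP; rewrite mulf_eq0 invr_eq0 pnatr_eq0 /= => /eqP.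
move=> sum0.
have edge i j : e i j -> x i 0 = x j 0.
  move=> eij; have term_ge0 := laplacian_term_ge0 x.
  have row0 : \sum_j (e i j)%:R * (x i 0 - x j 0) ^+ 2 = 0.
    by apply: (psumr_eq0P _ sum0) => // k _; exact: sumr_ge0.
  have /(_ j isT)/eqP := psumr_eq0P (fun j _ => term_ge0 i j) row0.
  by rewrite eij mul1r sqrf_eq0 subr_eq0 => /eqP.
move=> i j; have /connectP[p ep ->] := e_conn i j.
elim: p i ep => //= k p IH i /andP[/edge -> /IH //].
Qed.

Lemma laplacian_tr : L^T = L.
Proof.
rewrite /L /laplacian linearB /= tr_diag_mx; congr (_ - _).
by apply/matrixP => i j; rewrite !mxE e_sym.
Qed.

Lemma mixing_tr alpha : (mixing_mx e alpha)^T = mixing_mx e alpha :> 'M[R]_N.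
Proof. by rewrite /mixing_mx linearB linearZ /= trmx1 laplacian_tr. Qed.

Lemma mixing_ones alpha :
  mixing_mx e alpha *m const_mx 1 = const_mx 1 :> 'cV[R]_N.
Proof.
rewrite /mixing_mx mulmxBl mul1mx -scalemxAl.
rewrite (_ : laplacian R e *m _ = 0) ?scaler0 ?subr0 //.
apply/matrixP => i j; rewrite (ord1 j) laplacian_mulE [RHS]mxE.
by apply: big1 => k _; rewrite !mxE subrr mulr0.
Qed.

Lemma dot_mixing alpha (x : 'cV[R]_N) :
  dot x (mixing_mx e alpha *m x) = dot x x - alpha * dot x (L *m x).
Proof.
by rewrite /mixing_mx mulmxBl mul1mx dotDr dotNr -scalemxAl dotZr.
Qed.

(** By the Rayleigh bound, alpha <x, L x> <= alpha lambda |x|^2 < |x|^2. *)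
Lemma mixing_pd lambda alpha (x : 'cV[R]_N) :
  largest_eigenvalue L lambda -> 0 < alpha < 1 / lambda ->
  x != 0 -> 0 < dot x (mixing_mx e alpha *m x).
Proof.
move=> [_ Lmax] /andP[a0 al] x0.
(* Since 0 < 1 / lambda and inversion preserves signs (with 0 inverted to 0), lambda is positive. *)
have l0 : 0 < lambda by rewrite -invr_gt0 -div1r (lt_trans a0).
have := rayleigh_le _ _ _ laplacian_tr Lmax x.
rewrite ltr_pdivlMr // in al; rewrite -dot_gt0 in x0.
rewrite dot_mixing subr_gt0 -(ler_pM2l a0) mulrA => /le_lt_trans; apply.
by rewrite gtr_pMl.
Qed.

End Laplacian.

(** * Slices of a vector in R^(N D) *)

Section Kronecker.
Context {R : realType} {N D : nat}.

(** Collects the a-th component held by every node, so that W (x) I acts on each slice separately as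
    W. *)
Definition slice (x : 'cV[R]_(N * D)) (a : 'I_D) : 'cV[R]_N :=
  \col_i x (@mxtens_index _ _ (i, a)) 0.

Lemma sum_mxtens m n (F : 'I_(m * n) -> R) :
  \sum_k F k = \sum_(i < m) \sum_(j < n) F (@mxtens_index _ _ (i, j)).
Proof.
rewrite pair_big (reindex (@mxtens_index m n)); first by apply: eq_bigr => -[].
by apply: onW_bij; exists (@mxtens_unindex m n);
  [exact: mxtens_indexK|exact: mxtens_unindexK].
Qed.

Lemma dot_slice (x y : 'cV[R]_(N * D)) :
  dot x y = \sum_a dot (slice x a) (slice y a).
Proof.
rewrite dotE sum_mxtens exchange_big; apply: eq_bigr => a _.
by rewrite dotE; apply: eq_bigr => i _; rewrite !mxE.
Qed.

Lemma slice_tens (W : 'M[R]_N) x a :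
  slice ((W *t (1%:M : 'M[R]_D)) *m x) a = W *m slice x a.
Proof.
apply/matrixP => i j; rewrite !mxE sum_mxtens; apply: eq_bigr => k _.
rewrite (bigD1 a) //= big1 => [|b ba]; rewrite tensmxE !mxE ?addr0.
  by rewrite eqxx mulr1.
by rewrite eq_sym (negbTE ba) mulr0 mul0r.
Qed.

Lemma slice_eq0 (x : 'cV[R]_(N * D)) : (forall a, slice x a = 0) -> x = 0.
Proof.
move=> x0; apply/matrixP => k j; rewrite (ord1 j).
case: (mxtens_indexP k) => i a.
by have := congr1 (fun v : 'cV[R]_N => v i 0) (x0 a); rewrite !mxE.
Qed.

End Kronecker.

(** * The selector matrix is an orthogonal projector *)

Section Selector.
Context {R : realType} {N : nat} (d : 'I_N -> nat).

Local Notation D := (total_dim d).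
Local Notation P := (selector_mx R d).

Lemma ones_tensE (v : 'cV[R]_D) (i : 'I_N) a :
  (ones_tens v : 'cV_(N * D)) (@mxtens_index _ _ (i, a)) 0 = v a 0.
Proof. by rewrite !mxE mxtens_indexK mul1r (ord1 (_ _).2). Qed.

(** Translates the Kronecker indexing into the block indexing of [mxdiag], so that the selector can
    be multiplied block by block. *)
Lemma ones_tens_mxcol (v : 'cV[R]_D) :
  ones_tens v = castmx (sum_total_dim d, erefl) (\mxcol_(i < N) v).
Proof.
apply/matrixP => k j; rewrite (ord1 j); case: (mxtens_indexP k) => i a.
rewrite ones_tensE castmxE /=.
(* Both indices are i D + a: i blocks of height D precede the i-th one. *)
rewrite (_ : cast_ord _ _ = tagnat.Rank i a); last first.
  apply: val_inj; rewrite [RHS]tagnat.RankEsum /=; congr (_ + _)%N.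
  rewrite (big_ord_narrow (ltnW (ltn_ord i))) /=.
  by rewrite sum_nat_const card_ord.
rewrite mxE tagnat.Rank2K cast_ord_id.
by rewrite (ord1 (cast_ord _ _)).
Qed.

Lemma block_col_orth i :
  (block_col R d i)^T *m block_col R d i = 1%:M.
Proof.
rewrite /block_col tr_submxrow trmx1 mul_submxrow mulmx1.
apply/matrixP => a b; rewrite !mxE.
by rewrite -val_eqE tagnat.eq_Rank eqxx.
Qed.

Lemma block_proj_idem i :
  block_proj R d i *m block_proj R d i = block_proj R d i.
Proof.
rewrite /block_proj mulmxA -(mulmxA (block_col R d i)) block_col_orth.
by rewrite mulmx1.
Qed.

Lemma block_proj_tr i : (block_proj R d i)^T = block_proj R d i.
Proof. by rewrite /block_proj trmx_mul trmxK. Qed.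

(** Write I = I I, with the left factor cut into block columns and the right one into block rows. *)
Lemma sum_block_proj : \sum_i block_proj R d i = 1%:M.
Proof.
rewrite -[RHS]mulmx1 -{1}(submxrowK (1%:M : 'M[R]_D)).
rewrite -{2}(submxcolK (1%:M : 'M[R]_D)) mul_mxrow_mxcol.
by apply: eq_bigr => i _; rewrite /block_proj /block_col tr_submxrow trmx1.
Qed.

Lemma selector_tr : P^T = P.
Proof.
rewrite /selector_mx trmx_cast /= tr_mxdiag; congr castmx.
by apply: eq_mxdiag => i; exact: block_proj_tr.
Qed.

Lemma castmx_mulmx m n p m' n' p' (em : m = m') (en : n = n') (ep : p = p')
    (A : 'M[R]_(m, n)) (B : 'M[R]_(n, p)) :
  castmx (em, en) A *m castmx (en, ep) B = castmx (em, ep) (A *m B).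
Proof. by case: _ / em; case: _ / en; case: _ / ep. Qed.

Lemma selector_idem : P *m P = P.
Proof.
rewrite /selector_mx castmx_mulmx; congr castmx.
rewrite {2}/mxdiag mul_mxdiag_mxblock; apply/eq_mxblock => i j.
case: eqVneq => [ij|_]; last by rewrite mulmx0.
case: _ / ij.
by rewrite !conform_mx_id block_proj_idem.
Qed.

(** The blocks of P (1 (x) v) are the vectors P_i v, and these sum to v. *)
Lemma selector_ones_ker (v : 'cV[R]_D) : P *m ones_tens v = 0 -> v = 0.
Proof.
rewrite ones_tens_mxcol /selector_mx castmx_mulmx mul_mxdiag_mxcol.
move/(congr1 (castmx (esym (sum_total_dim d), esym erefl))).
rewrite castmxK castmx_const => Pv0.
have {Pv0} Pv : forall i, block_proj R d i *m v = 0.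
  by apply/eq_mxcolP; rewrite Pv0 mxcol0.
by rewrite -[v]mul1mx -sum_block_proj mulmx_suml big1.
Qed.

Lemma dot_selector x : dot x (P *m x) = dot (P *m x) (P *m x).
Proof.
by rewrite [RHS]dot_mulmxr selector_tr mulmxA selector_idem dotC.
Qed.

End Selector.

(** * Contractivity of the system matrix and the error step *)

Section System.
Context {R : realType} {N : nat} (e : rel 'I_N) (d : 'I_N -> nat).
Context (alpha lambda : R).
Context (e_sym : symmetric e) (e_conn : forall i j, connect e i j).
Context (lambda_max : largest_eigenvalue (laplacian R e) lambda).
Context (alpha_lt : 0 < alpha < 1 / lambda).

Local Notation D := (total_dim d).
Local Notation W := (mixing_mx e alpha).
Local Notation WI := (W *t (1%:M : 'M[R]_D)).
Local Notation P := (selector_mx R d).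
Local Notation A := (system_mx d W).

Lemma system_tr : A^T = A.
Proof.
by rewrite /system_mx linearB /= trmx_tens mixing_tr // trmx1 selector_tr.
Qed.

(** The form is the sum over slices of the positive definite form of W, and some slice of x is
    nonzero. *)
Lemma mixing_tens_pd x : x != 0 -> 0 < dot x (WI *m x).
Proof.
move=> x0; have [a xa0] : exists a, slice x a != 0.
  apply/existsP; apply: contraNT x0; rewrite negb_exists => /forallP x0.
  by apply/eqP/slice_eq0 => a; apply/eqP; rewrite -[_ == _]negbK.
have quad_ge0 b : 0 <= dot (slice x b) (slice (WI *m x) b).
  rewrite slice_tens; have [->|xb0] := eqVneq (slice x b) 0.
    by rewrite mulmx0 dot0r.
  exact/ltW/(mixing_pd _ e_sym _ _ _ lambda_max alpha_lt).
rewrite dot_slice (bigD1 a) //= ltr_pwDl ?sumr_ge0 //.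
by rewrite slice_tens; exact: (mixing_pd _ e_sym _ _ _ lambda_max alpha_lt).
Qed.

(** The difference of the two sides is |x - P x|^2. *)
Lemma selector_le x : dot x (P *m x) <= dot x x.
Proof.
have := dot_ge0 _ (x - P *m x).
rewrite !(dotDl, dotDr, dotNl, dotNr) -dot_selector (dotC _ (P *m x)).
lra.
Qed.

Lemma system_gt x : x != 0 -> 0 < dot x (x + A *m x).
Proof.
move=> /mixing_tens_pd Wx; have := selector_le x.
rewrite /system_mx mulmxBl !(dotDr, dotNr); lra.
Qed.

Lemma dot_mixing_tens x :
  dot x (WI *m x) =
  dot x x - alpha * \sum_a dot (slice x a) (laplacian R e *m slice x a).
Proof.
rewrite !dot_slice mulr_sumr -sumrB; apply: eq_bigr => a _.
by rewrite slice_tens dot_mixing.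
Qed.

(** The form is alpha S + |P x|^2, where S sums the Laplacian forms of the slices. If it is not
    positive, both terms vanish: S = 0 makes x = 1 (x) v, and P x = 0 then gives v = 0. *)
Lemma system_lt x : x != 0 -> 0 < dot x (x - A *m x).
Proof.
have /andP[a0 _] := alpha_lt.
set S := \sum_a dot (slice x a) (laplacian R e *m slice x a).
have S0 : 0 <= S by rewrite sumr_ge0 // => a _; exact: laplacian_psd.
have -> : dot x (x - A *m x) = alpha * S + dot (P *m x) (P *m x).
  rewrite /system_mx mulmxBl !(dotDr, dotNr) dot_mixing_tens -dot_selector -/S.
  ring.
apply: contraNT; rewrite -leNgt => le0.
have Px_ge0 := dot_ge0 _ (P *m x).
have aS_ge0 : 0 <= alpha * S by rewrite mulr_ge0 // ltW.
have /eqP : alpha * S = 0 by lra.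
rewrite mulf_eq0 gt_eqF //= => /eqP S_eq0.
have /eqP : dot (P *m x) (P *m x) = 0 by lra.
rewrite dot_eq0 => /eqP Px0.
have const a i j : x (mxtens_index (i, a)) 0 = x (mxtens_index (j, a)) 0.
  have Sa : dot (slice x a) (laplacian R e *m slice x a) = 0.
    by apply: (psumr_eq0P _ S_eq0) => // b _; exact: laplacian_psd.
  by have := laplacian_ker _ e_sym e_conn _ Sa i j; rewrite !mxE.
(* A node is required to read off v; without nodes x has no entries. *)
have [i0|noi] := pselect (exists i : 'I_N, true); last first.
  apply/eqP/matrixP => k j; case: (mxtens_indexP k) => i a.
  by case: noi; exists i.
case: i0 => i0 _.
have xE : x = ones_tens (\col_a x (mxtens_index (i0, a)) 0).
  apply/matrixP => k j; rewrite (ord1 j); case: (mxtens_indexP k) => i a.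
  by rewrite ones_tensE mxE.
rewrite xE in Px0 *; rewrite (selector_ones_ker _ _ Px0).
by rewrite /ones_tens tensmx0.
Qed.

Lemma system_spectral_norm :
  0 <= spectral_norm A < 1 /\
  forall x, norm2 (A *m x) <= spectral_norm A * norm2 x.
Proof.
apply: (spectral_norm_lt1 _ A) => x x0.
apply: (contraction_pd _ A) => //.
- exact: system_tr.
- exact: system_gt.
- exact: system_lt.
Qed.

Lemma ones_tensB (u v : 'cV[R]_D) :
  ones_tens (u - v) = ones_tens u - ones_tens v :> 'cV_(N * D).
Proof. by apply/matrixP => k j; rewrite !mxE mulrBr. Qed.

Lemma norm2_ones_tens (v : 'cV[R]_D) :
  norm2 (ones_tens v : 'cV_(N * D)) = Num.sqrt N%:R * norm2 v.
Proof.
rewrite !norm2E -sqrtrM // dotE sum_mxtens; congr Num.sqrt.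
under eq_bigr do under eq_bigr do rewrite ones_tensE.
by rewrite -dotE sumr_const card_ord mulr_natl.
Qed.

Lemma mixing_ones_tens (v : 'cV[R]_D) : WI *m ones_tens v = ones_tens v.
Proof.
apply: etrans (tensmx_mul W 1%:M (const_mx 1 : 'cV[R]_N) v) _.
by rewrite mixing_ones mul1mx.
Qed.

(** As W (x) I fixes 1 (x) v, the anchor can be subtracted inside both terms. *)
Lemma error_step (v : 'cV[R]_D) x :
  WI *m x + P *m (ones_tens v - x) - ones_tens v = A *m (x - ones_tens v).
Proof.
rewrite /system_mx mulmxBl !mulmxBr mixing_ones_tens.
rewrite opprB [RHS]addrC addrAC -!addrA [RHS]addrA [RHS]addrCA.
by congr (_ + _); exact: addrC.
Qed.

End System.

(** * Affine recursions and limits superior *)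

Section Limsup.
Context {R : realType}.

Lemma limn_esup_geometric (a : nat -> R) q C l : 0 <= q < 1 ->
  (forall k, a k <= q ^+ k * C + l) ->
  (limn_esup (fun k => (a k)%:E) <= l%:E)%E.
Proof.
move=> /andP[q0 q1] ale.
have cb : (fun k => (q ^+ k * C + l)%:E) @ \oo --> l%:E.
  apply/cvg_EFin; first exact: nearW.
  rewrite -[X in _ --> X]add0r -{1}(mul0r C).
  apply: cvgD; last exact: cvg_cst.
  by apply: cvgMl; apply: cvg_expr; rewrite ger0_norm.
(* The majorant converges to l, so its tail suprema do too; they dominate those of [a]. *)
rewrite limn_esup_lim -(cvg_lim _ (cvg_esups cb)) //.
apply: lee_lim; [exact: is_cvg_esups|exact: is_cvg_esups|].
apply: nearW => n; apply: ge_ereal_sup => _ [k nk <-].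
apply: (@le_trans _ _ (q ^+ k * C + l)%:E); first by rewrite lee_fin.
by apply: ereal_sup_ubound; exists k.
Qed.

(** The fixed point of x -> q x + b is b / (1 - q), and the excess over it shrinks by q at each
    step. *)
Lemma affine_recursion_le (a : nat -> R) q b : 0 <= q < 1 ->
  (forall k, a k.+1 <= q * a k + b) ->
  forall k, a k <= q ^+ k * (a 0 - b / (1 - q)) + b / (1 - q).
Proof.
move=> /andP[q0 q1] astep; elim=> [|k IH]; first by rewrite expr0 mul1r subrK.
apply: le_trans (astep k) _.
apply: (@le_trans _ _ (q * (q ^+ k * (a 0 - b / (1 - q)) + b / (1 - q)) + b)).
  by rewrite lerD2r ler_wpM2l.
rewrite exprS le_eqVlt; apply/orP; left; apply/eqP.
by field; rewrite subr_eq0 gt_eqF.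
Qed.

End Limsup.

(** * Error recursion across outer iterations and the two bounds *)

Theorem corollary1 (R : realType) (N : nat) (hN : (2 <= N)%N)
    (e : rel 'I_N) (e_sym : symmetric e) (e_irr : irreflexive e)
    (e_conn : forall i j : 'I_N, connect e i j)
    (lambdaN : R) (hlambdaN : largest_eigenvalue (laplacian R e) lambdaN)
    (alpha : R) (halpha : 0 < alpha < 1 / lambdaN)
    (d : 'I_N -> nat)
    (T : nat) (hT : (1 <= T)%N)
    (Delta : R) (u : nat -> 'cV[R]_(total_dim d))
    (hu : forall k : nat, norm2 (u k.+1 - u k) <= Delta)
    (s : nat -> nat -> 'cV[R]_(N * total_dim d))
    (s_inner : forall k t : nat, (t < T)%N ->
       s k t.+1 = (mixing_mx e alpha *t (1%:M : 'M[R]_(total_dim d))) *m s k t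
                  + selector_mx R d *m (ones_tens (u k) - s k t))
    (s_warm : forall k : nat, s k.+1 0%N = s k T) :
  let sigma := spectral_norm (system_mx d (mixing_mx e alpha)) in
  let err := fun k t : nat => s k t - ones_tens (u k) in
  [/\ 0 <= sigma < 1,
      (limn_esup (fun k => (norm2 (err k 0%N))%:E)
         <= (Num.sqrt N%:R / (1 - sigma ^+ T) * Delta)%:E)%E
    & (limn_esup (fun k => (norm2 (err k T))%:E)
         <= (Num.sqrt N%:R * sigma ^+ T / (1 - sigma ^+ T) * Delta)%:E)%E].
Proof.
move=> sigma err.
have [sigma01 Abound] :=
  system_spectral_norm e d alpha lambdaN e_sym e_conn hlambdaN halpha.
rewrite -/sigma in sigma01 Abound; have /andP[sigma0 sigma1] := sigma01.
(* Within one outer iteration the anchor u^k is fixed, so each inner round contracts the error by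
   sigma. *)
have inner k t : (t <= T)%N ->
    norm2 (err k t) <= sigma ^+ t * norm2 (err k 0%N).
  elim: t => [|t IH] tT; first by rewrite expr0 mul1r.
  rewrite {1}/err s_inner // error_step; apply: le_trans (Abound _) _.
  by rewrite exprS -mulrA ler_wpM2l // IH // ltnW.
set q := sigma ^+ T.
have q01 : 0 <= q < 1 by rewrite exprn_ge0 //= exprn_ilt1 // -lt0n.
have outer k :
    norm2 (err k.+1 0%N) <= q * norm2 (err k 0%N) + Num.sqrt N%:R * Delta.
  (* The warm start keeps the state while the anchor jumps by 1 (x) Delta u^k, whose norm is at most
     sqrt N Delta. *)
  have -> : err k.+1 0%N = err k T + - ones_tens (u k.+1 - u k).
    by rewrite /err s_warm ones_tensB opprB addrA subrK.
  apply: le_trans (ler_norm2D _ _ _) _; rewrite norm2N norm2_ones_tens.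
  by apply: lerD; [exact: inner|rewrite ler_wpM2l ?sqrtr_ge0].
have err_le := affine_recursion_le _ _ _ q01 outer.
set l := Num.sqrt N%:R * Delta / (1 - q) in err_le.
split=> //.
  rewrite mulrAC -/l; exact: limn_esup_geometric q01 err_le.
(* The second bound is q times the first, because T inner rounds contract the initial error by q. *)
rewrite (_ : _ * Delta = q * l); last by rewrite /l; ring.
apply: (limn_esup_geometric _ q (q * (norm2 (err 0%N 0%N) - l))) => // k.
apply: le_trans (inner k T (leqnn T)) _.
by rewrite mulrCA -mulrDr ler_wpM2l // exprn_ge0.
Qed.
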